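(* For all $\beta\ge0$, $\mu\in\mathbb{R}$ and $d\in\mathbb{N}$, the function $F_{\beta,\mu,d}$ is windable; that is, for every integer $1\le m\le d$ and every pinning $G$ of $F_{\beta,\mu,d}$ of arity $m$, letting $H(x)=G(x)G(\bar x)$ with half-vector $\mathbf{h}=[h_0,\dots,h_n]$ ($n=\lfloor m/2\rfloor$), the linear system $A_m\mathbf{x}=\mathbf{h}$ has a solution $\mathbf{x}\in\mathbb{R}_{\ge0}^{n+1}$.
   Context: $F_{\beta,\mu,d}:\{0,1\}^d\to\mathbb{R}_{\ge0}$ is the symmetric function with value $e^{\beta i(d-i)+\mu i}$ on inputs with exactly $i$ ones. A symmetric function $F:\{0,1\}^d\to\mathbb{R}_{\ge0}$ has signature vector $[f_0,\dots,f_d]$ where $f_i$ is its value on inputs of Hamming weight $i$. A pinning of $F$ is a function $G:\{0,1\}^m\to\mathbb{R}_{\ge0}$, $G(x_1,\dots,x_m)=F(x_1,\dots,x_m,0,\dots,0,1,\dots,1)$ with $d-b$ zeros and $a$ ones, where $0\le a\le b\le d$ and $m=b-a$ (signature $[f_a,\dots,f_b]$). $\bar x$ denotes the bitwise complement of $x$. The function $H(x)=G(x)G(\bar x)$ is symmetric with $H$ taking value $h_i=h_{m-i}$ on weight $i$; its half-vector is $[h_0,\dots,h_{\lfloor m/2\rfloor}]$. For $m\ge1$, $n=\lfloor m/2\rfloor$, $A_m=(a^{(m)}_{i,j})_{0\le i,j\le n}$ where, for $m=2n$: $a^{(m)}_{i,j}=\binom{i}{j}\binom{2n-i}{j}j!(i-j-1)!!(2n-i-j-1)!!$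 if $i\equiv j \pmod 2$ and $0$ otherwise; for $m=2n+1$: $a^{(m)}_{i,j}=\binom{i}{j}\binom{2n+1-i}{j}j!(i-j-1)!!(2n+1-i-j)!!$ if $i\equiv j\pmod 2$ and $\binom{i}{j}\binom{2n+1-i}{j}j!(i-j)!!(2n-i-j)!!$ otherwise. Here $x!!=x(x-2)(x-4)\cdots$ (down to 1 or 2) for $x\in\mathbb{N}$, $(-1)!!=1$, and $\binom{b}{a}=0$ if $a<0$ or $a>b$ (so $a^{(m)}_{i,j}=0$ for $j>i$). By a theorem of Huang, Lu and Zhang, the stated nonnegative-solvability condition over all pinnings is equivalent to windability of $F$ in the sense of McQuillan. *)

(* Defs.v *)
From HB Require Import structures.
From mathcomp Require Import all_boot all_order all_algebra.
From mathcomp Require Import reals sequences exp.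

Set Implicit Arguments.
Unset Strict Implicit.
Unset Printing Implicit Defensive.

Import Order.TTheory GRing.Theory Num.Theory.
Local Open Scope ring_scope.

Definition hamming (d : nat) (x : d.-tuple bool) : nat := count id x.

Definition compl (d : nat) (x : d.-tuple bool) : d.-tuple bool :=
  map_tuple negb x.

Definition Fbmd (R : realType) (beta mu : R) (d : nat) (x : d.-tuple bool) : R :=
  let i := (hamming x)%:R in
  expR (beta * i * (d%:R - i) + mu * i).

(* The input (x_1, .., x_m, 0, .., 0, 1, .., 1) with d - b zeros and a ones.
   When a <= b <= d and m = b - a the concatenation has size exactly d, so the
   default value of nth is never used. *)
Definition pin_input (d m a b : nat) (x : m.-tuple bool) : d.-tuple bool :=
  [tuple nth false (x ++ nseq (d - b) false ++ nseq a true) i | i < d].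

Definition is_pinning (R : realType) (d m : nat)
    (F : d.-tuple bool -> R) (G : m.-tuple bool -> R) : Prop :=
  exists a b : nat, [/\ (a <= b <= d)%N, m = (b - a)%N
    & forall x : m.-tuple bool, G x = F (pin_input d a b x)].

Definition self_compl (R : realType) (m : nat) (G : m.-tuple bool -> R)
    (x : m.-tuple bool) : R := G x * G (compl x).

(* h_i is read off at the weight-i input 1^i 0^(m-i); for a symmetric H the
   choice of the weight-i input is immaterial. *)
Definition half_vector (R : realType) (m : nat) (H : m.-tuple bool -> R) :
    'cV[R]_((m./2).+1) :=
  \col_(i < (m./2).+1) H [tuple (j < i)%N | j < m].

Fixpoint dfact (x : nat) : nat :=
  if x is y.+2 then (x * dfact y)%N else 1%N.

(* Subtraction is truncated. When j <= i <= n the only negative arguments of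
   a double factorial are equal to -1; they become 0, and dfact 0 = 1 agrees
   with (-1)!! = 1. When j > i the factor 'C(i, j) vanishes. *)
Definition a_entry (m i j : nat) : nat :=
  (let n := m./2 in
  if odd m then
    if odd i == odd j then
      'C(i, j) * 'C(2 * n + 1 - i, j) * j`!
        * dfact (i - j - 1) * dfact (2 * n + 1 - i - j)
    else
      'C(i, j) * 'C(2 * n + 1 - i, j) * j`!
        * dfact (i - j) * dfact (2 * n - i - j)
  else
    if odd i == odd j then
      'C(i, j) * 'C(2 * n - i, j) * j`!
        * dfact (i - j - 1) * dfact (2 * n - i - j - 1)
    else 0)%N.

Definition A_mx (R : realType) (m : nat) : 'M[R]_((m./2).+1) :=
  \matrix_(i, j) (a_entry m i j)%:R.

(* The criterion, over all pinnings, by which Huang, Lu and Zhang characterize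
   McQuillan's windability for symmetric functions. *)
Definition windable (R : realType) (d : nat) (F : d.-tuple bool -> R) : Prop :=
  forall (m : nat) (G : m.-tuple bool -> R),
    (1 <= m <= d)%N -> is_pinning F G ->
    exists x : 'cV[R]_((m./2).+1),
      (forall i, 0 <= x i 0) /\ A_mx R m *m x = half_vector (self_compl G).

(* Main.v *)
Require Import Defs.
From mathcomp Require Import all_boot all_order all_algebra.
From mathcomp Require Import reals sequences exp.
From mathcomp Require Import classical_sets topology normedtype.
From mathcomp Require Import zify ring.

(** Up to a positive constant, h_i = exp (2 beta i (m - i)).  The entry a_ij
    counts the matchings of i red and m - i blue points (with one point left
    over if m is odd) that have exactly j bicolored pairs.  Replacing a red-red
    and a blue-blue pair by two bicolored ones, or, for odd m, letting the
    leftover point be exchanged, gives A T = D A with D = diag (i (m - i)) and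
    T entrywise nonnegative.  The total number of matchings does not depend on
    i, so A x = 1 has a positive constant solution x, and therefore
    A (exp (s T) x) = exp (s D) 1 with exp (s T) x >= 0 for s = 2 beta. *)

Import Order.TTheory GRing.Theory Num.Theory.
Import numFieldNormedType.Exports.
Local Open Scope ring_scope.

(** * Entries of the matrix as matching numbers *)

(* The number of perfect matchings of k points. *)
Fixpoint pmatch (k : nat) : nat :=
  match k with
  | 0 => 1
  | 1 => 0
  | (k'.+1 as l).+1 => l * pmatch k'
  end%N.

Arguments pmatch : simpl never.

Lemma pmatchS (k : nat) : (pmatch k.+1 = k * pmatch k.-1)%N.
Proof. by case: k. Qed.

Lemma pmatch_odd (k : nat) : odd k -> pmatch k = 0%N.
Proof.
elim/ltn_ind: k => -[|[|k]] IH //= ok.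
by rewrite pmatchS IH ?muln0 //= -[odd k]negbK.
Qed.

Lemma pmatch_even (k : nat) : ~~ odd k -> pmatch k = dfact (k - 1).
Proof.
elim/ltn_ind: k => -[|[|[|k]]] IH // ek.
rewrite pmatchS IH //; last by move: ek; rewrite /= negbK.
by rewrite !subn1.
Qed.

(** Counts the sets of [j] disjoint bicolored pairs among [p] red and [q] blue points. *)
Definition pair_matchings (p q j : nat) : nat :=
  ('C(p, j) * 'C(q, j) * j`!)%N.

(* For odd m one point stays unmatched; it is matched to a phantom point,
   of either colour. *)
Definition rest_matchings (b : bool) (u v : nat) : nat :=
  (if b then pmatch u * pmatch v.+1 + pmatch u.+1 * pmatch v
   else pmatch u * pmatch v)%N.

(** Since [pmatch] vanishes at odd arguments, it absorbs the parity tests of [a_entry]: for odd [m]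
    exactly one summand of [rest_matchings] survives when [j <= i] and [j <= m - i]. *)
Lemma a_entryE (m i j : nat) : (i <= m)%N ->
  a_entry m i j =
    (pair_matchings i (m - i) j * rest_matchings (odd m) (i - j) (m - i - j))%N.
Proof.
move=> im; rewrite /a_entry /pair_matchings /rest_matchings.
have mE : m = (odd m + 2 * m./2)%N by rewrite mul2n odd_double_half.
case: (leqP j i) => [ji|ij]; last first.
  by rewrite bin_small // !mul0n; case: ifP; case: ifP.
case: (leqP j (m - i)) => [jm|mj]; last first.
  have -> : 'C(m - i, j) = 0%N by rewrite bin_small.
  case om: (odd m) mE => mE.
    rewrite (_ : 2 * m./2 + 1 = m)%N; last by lia.
    by rewrite [in X in X = _](bin_small mj) !(muln0, mul0n); case: ifP.
  rewrite (_ : 2 * m./2 = m)%N; last by lia.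
  by rewrite [in X in X = _](bin_small mj) !(muln0, mul0n); case: ifP.
case om: (odd m) mE => mE.
  rewrite (_ : 2 * m./2 + 1 = m)%N; last by lia.
  rewrite (_ : 2 * m./2 = m.-1)%N; last by lia.
  case: ifP => ij.
    rewrite [pmatch (i - j).+1]pmatch_odd; last by lia.
    rewrite mul0n addn0 !pmatch_even; try lia.
    by rewrite !subn1 mulnA.
  rewrite [pmatch (i - j)]pmatch_odd; last by lia.
  rewrite mul0n add0n !pmatch_even; try lia.
  by rewrite !subn1 /= mulnA; congr (_ * dfact _)%N; lia.
rewrite (_ : 2 * m./2 = m)%N; last by lia.
case: ifP => ij; last by rewrite [pmatch (i - j)]pmatch_odd ?mul0n ?muln0 //; lia.
by rewrite !pmatch_even ?mulnA //; lia.
Qed.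

Lemma pair_matchingsS (p q j : nat) :
  (j.+1 * pair_matchings p q j.+1 = (p - j) * (q - j) * pair_matchings p q j)%N.
Proof.
rewrite /pair_matchings factS.
have Ep := mul_bin_left p j; have Eq := mul_bin_left q j.
transitivity ((j.+1 * 'C(p, j.+1)) * (j.+1 * 'C(q, j.+1)) * j`!)%N; first ring.
by rewrite Ep Eq; ring.
Qed.

(** Fix one red and one blue point. Either both have real partners, or one of them is the leftover
    point; deleting the latter lets the other act as the phantom. The factor [u * v] covers the
    cases where a predecessor truncates at [0]. *)
Lemma rest_matchings_rec (b : bool) (u v : nat) :
  (u * v * rest_matchings b u v =
   u * v * (u.-1 * v.-1 * rest_matchings b u.-2 v.-2
            + b * rest_matchings b u.-1 v.-1))%N.
Proof.
case: u v => [|u] [|v]; rewrite ?muln0 ?mul0n //=.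
congr (_ * _ * _)%N; rewrite /rest_matchings.
case: b => /=; rewrite ?mul1n ?mul0n ?addn0.
  by case: u v => [|u] [|v]; rewrite !pmatchS ?/= ?pmatchS /=; ring.
by rewrite !pmatchS; ring.
Qed.

(** Double counting of matchings with a marked red point r and blue point b outside the bicolored
    pairs. Switching rr', bb' to rb, r'b' gives an ordered choice of two among [j.+2] bicolored
    pairs; if r or b is the leftover point, pairing r with b gives one marked pair among [j.+1]. *)
Lemma a_entry_switch (m i j : nat) : (i <= m)%N ->
  (i * (m - i) * a_entry m i j = j * (m - j) * a_entry m i j
   + j.+1 * j.+2 * a_entry m i j.+2 + odd m * j.+1 * a_entry m i j.+1)%N.
Proof.
move=> im.
case: (leqP j i) => [ji|ij]; last first.
  have z k : (j <= k)%N -> a_entry m i k = 0%N.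
    by move=> jk; rewrite a_entryE // /pair_matchings bin_small ?mul0n //; lia.
  by rewrite !z ?muln0 //; lia.
case: (leqP j (m - i)) => [jm|mj]; last first.
  have z k : (j <= k)%N -> a_entry m i k = 0%N.
    move=> jk; rewrite a_entryE // /pair_matchings.
    by rewrite ['C(m - i, k)]bin_small ?muln0 ?mul0n //; lia.
  by rewrite !z ?muln0 //; lia.
rewrite !a_entryE //.
(* The second summand counts the marked choices; the first is the diagonal part of the switching
   matrix. *)
have -> : (i * (m - i) = j * (m - j) + (i - j) * (m - i - j))%N by nia.
have E1 := pair_matchingsS i (m - i) j.
have E2 := pair_matchingsS i (m - i) j.+1.
have R := rest_matchings_rec (odd m) (i - j) (m - i - j).
rewrite !subnS in E2 *.
set c0 := pair_matchings _ _ j in E1 E2 *.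
set c1 := pair_matchings _ _ j.+1 in E1 E2 *.
set c2 := pair_matchings _ _ j.+2 in E1 E2 *.
move: R; set u := (i - j)%N; set v := (m - i - j)%N => R.
set f0 := rest_matchings _ u v in R *.
rewrite mulnDl -[RHS]addnA; congr (_ + _)%N.
transitivity (c0 * (u * v * f0))%N; first ring.
rewrite {}R.
set f1 := rest_matchings _ u.-1 _; set f2 := rest_matchings _ u.-2 _.
transitivity ((u.-1 * v.-1 * (u * v * c0)) * f2 + odd m * (u * v * c0) * f1)%N; first ring.
rewrite -E1.
transitivity (j.+1 * (u.-1 * v.-1 * c1) * f2 + odd m * (j.+1 * c1) * f1)%N; first ring.
by rewrite -E2; ring.
Qed.

(** * Row sums *)

Definition bicolored_matchings (p q j : nat) : nat :=
  (pair_matchings p q j * (pmatch (p - j) * pmatch (q - j)))%N.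

(** Classify by the partner of one fixed red point: one of [p] red or one of [q] blue points. *)
Lemma bicolored_matchingsS (p q j : nat) :
  (bicolored_matchings p.+1 q j.+1 =
   p * bicolored_matchings p.-1 q j.+1 + q * bicolored_matchings p q.-1 j)%N.
Proof.
rewrite /bicolored_matchings /pair_matchings subSS.
have Eq : (q * 'C(q.-1, j) = j.+1 * 'C(q, j.+1))%N.
  by case: q => [|q] /=; rewrite ?mul0n ?muln0 // mul_bin_diag.
have Ep : (p * 'C(p.-1, j.+1) * pmatch (p.-1 - j.+1) = 'C(p, j.+1) * pmatch (p - j))%N.
  rewrite mul_bin_down; case: (leqP p j) => [pj|jp].
    by rewrite bin_small ?muln0.
  have -> : (p - j = (p - j.+1).+1)%N by lia.
  rewrite pmatchS (_ : (p - j.+1).-1 = p.-1 - j.+1)%N; last by lia.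
  ring.
rewrite binS factS (_ : q.-1 - j = q - j.+1)%N; last by lia.
transitivity (('C(p, j.+1) * pmatch (p - j)) * 'C(q, j.+1) * (j.+1 * j`!) * pmatch (q - j.+1)
  + 'C(p, j) * (j.+1 * 'C(q, j.+1)) * j`! * pmatch (p - j) * pmatch (q - j.+1))%N; first ring.
by rewrite -Ep -Eq; ring.
Qed.

Lemma bicolored_matchings0 (p q : nat) :
  bicolored_matchings p q 0 = (pmatch p * pmatch q)%N.
Proof. by rewrite /bicolored_matchings /pair_matchings !bin0 !subn0 !mul1n. Qed.

(** Each perfect matching of all [p + q] points has a unique number [j] of bicolored pairs, and
    [j <= p < N]. *)
Lemma sum_bicolored_matchings (N p q : nat) : (p < N)%N ->
  (\sum_(j < N) bicolored_matchings p q j)%N = pmatch (p + q).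
Proof.
elim/ltn_ind: p N q => -[|p] IH [//|N] q pN; rewrite big_ord_recl /= bicolored_matchings0.
  by rewrite mul1n big1 ?addn0.
(* The factors [p] and [q] stay in [IH1] and [IH2] because the predecessors truncate at [0]. *)
have IH1 : (p * \sum_(j < N.+1) bicolored_matchings p.-1 q j = p * pmatch (p + q).-1)%N.
  by case: p IH pN => [|p] IH pN; rewrite ?mul0n // IH //= ; lia.
have IH2 : (q * \sum_(j < N) bicolored_matchings p q.-1 j = q * pmatch (p + q).-1)%N.
  by case: q IH1 => [|q] _; rewrite ?mul0n // IH //= addnS.
under eq_bigr => j _ do rewrite /bump /= add1n bicolored_matchingsS.
rewrite big_split /= -!big_distrr /= addSn [RHS]pmatchS mulnDl -IH1 -IH2.
rewrite big_ord_recl /= bicolored_matchings0 pmatchS; ring.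
Qed.

Lemma sum_a_entry (m : nat) (i : 'I_(m./2).+1) :
  (\sum_(j < (m./2).+1) a_entry m i j)%N =
  if odd m then (m * pmatch m.-1)%N else pmatch m.
Proof.
have im : (i <= m)%N by have := ltn_ord i; lia.
under eq_bigr => j _ do rewrite a_entryE //.
rewrite /rest_matchings; case: ifP => om; last first.
  by rewrite sum_bicolored_matchings ?subnKC.
(* Classify by the colour of the leftover point: [q] blue or [p] red choices. *)
have E p q j : (j <= p)%N -> (j <= q)%N ->
  (pair_matchings p q j *
    (pmatch (p - j) * pmatch (q - j).+1 + pmatch (p - j).+1 * pmatch (q - j)) =
   q * bicolored_matchings p q.-1 j + p * bicolored_matchings p.-1 q j)%N.
  move=> jp jq; rewrite /bicolored_matchings /pair_matchings !pmatchS.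
  have Ep := mul_bin_down p j; have Eq := mul_bin_down q j.
  have -> : (p.-1 - j = (p - j).-1)%N by lia.
  have -> : (q.-1 - j = (q - j).-1)%N by lia.
  transitivity ('C(p, j) * ((q - j) * 'C(q, j)) * j`! * pmatch (p - j) * pmatch (q - j).-1
    + ((p - j) * 'C(p, j)) * 'C(q, j) * j`! * pmatch (q - j) * pmatch (p - j).-1)%N; first ring.
  by rewrite -Ep -Eq; ring.
rewrite (eq_bigr (fun j : 'I__ => (m - i) * bicolored_matchings i (m - i).-1 j
    + i * bicolored_matchings i.-1 (m - i) j))%N; last first.
  move=> j _; case: (leqP j i) => [ji|ij].
    by rewrite E //; have := ltn_ord i; lia.
  rewrite /bicolored_matchings /pair_matchings !['C(i, j)]bin_small //.
  by rewrite ['C(i.-1, j)]bin_small ?mul0n ?muln0 //; lia.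
rewrite big_split /= -!big_distrr /= !sum_bicolored_matchings ?ltn_ord //; last first.
  by have := ltn_ord i; lia.
have -> : (i + (m - i).-1 = m.-1)%N by have := ltn_ord i; lia.
case: (posnP i) => [->|i0]; first by rewrite mul0n addn0 subn0.
have -> : (i.-1 + (m - i) = m.-1)%N by lia.
by rewrite -mulnDl subnK.
Qed.

Lemma pmatch_gt0 (k : nat) : ~~ odd k -> (0 < pmatch k)%N.
Proof.
elim/ltn_ind: k => -[|[|k]] IH // ek.
by rewrite pmatchS muln_gt0 /= IH //; move: ek; rewrite /= negbK.
Qed.

Lemma a_entry_diag_gt0 (m i : nat) : (i <= m./2)%N -> (0 < a_entry m i i)%N.
Proof.
move=> im; rewrite a_entryE; last by lia.
rewrite /pair_matchings /rest_matchings subnn !muln_gt0 !bin_gt0 fact_gt0 leqnn !andbT /=.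
apply/andP; split; first by lia.
by case: ifP => om; rewrite ?mul1n ?mul0n ?addn0 pmatch_gt0 //; lia.
Qed.

(** * Matrix identities *)

(** Column [j] holds the coefficients of [a_entry_switch]. Indices are compared in [nat] since
    [j.+1] and [j.+2] may exceed [m./2]; [a_entry m i] vanishes there for [i <= m./2]. *)
Definition switch_mx (R : realType) (m : nat) : 'M[R]_((m./2).+1) :=
  \matrix_(k, j) ((k == j :> nat) * (j * (m - j)) + (k == j.+2 :> nat) * (j.+1 * j.+2)
                  + (k == j.+1 :> nat) * (odd m * j.+1))%:R.

Lemma A_mx_switch (R : realType) (m : nat) :
  A_mx R m *m switch_mx R m =
  diag_mx (\row_(i < (m./2).+1) (i * (m - i))%:R) *m A_mx R m.
Proof.
apply/matrixP => i j; rewrite mul_diag_mx !mxE.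
have im : (i <= m)%N by have := ltn_ord i; lia.
under eq_bigr => k _ do rewrite !mxE -natrM.
rewrite -natr_sum -natrM; congr _%:R.
have pick l c :
    (\sum_(k < (m./2).+1) a_entry m i k * ((k == l :> nat) * c) = a_entry m i l * c)%N.
  case: (ltnP l (m./2).+1) => [lm|ml].
    rewrite (bigD1 (Ordinal lm)) //= eqxx mul1n big1 ?addn0 // => k kl.
    by rewrite (_ : (k == l :> nat) = false) ?mul0n ?muln0 //; exact: negbTE.
  rewrite (_ : a_entry m i l = 0%N) ?mul0n.
    rewrite big1 // => k _.
    by rewrite (_ : (k == l :> nat) = false) ?mul0n ?muln0 //; have := ltn_ord k; lia.
  rewrite a_entryE // /pair_matchings bin_small ?mul0n //.
  by have := ltn_ord i; lia.
under eq_bigr => k _ do rewrite !mulnDr.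
rewrite !big_split /= !pick a_entry_switch //; ring.
Qed.

Lemma A_mx_unit (R : realType) (m : nat) : A_mx R m \in unitmx.
Proof.
rewrite unitmxE det_trig.
  rewrite unitfE prodf_seq_neq0; apply/allP => i _ /=.
  by rewrite mxE pnatr_eq0 -lt0n a_entry_diag_gt0 // -ltnS.
apply/is_trig_mxP => i j ij; rewrite mxE a_entryE /pair_matchings.
  by rewrite bin_small.
by have := ltn_ord i; lia.
Qed.

Lemma A_mx_const (R : realType) (m : nat) : exists2 c : R, 0 < c &
  A_mx R m *m const_mx c = const_mx 1 :> 'cV_((m./2).+1).
Proof.
set r := (if odd m then m * pmatch m.-1 else pmatch m)%N.
have r0 : (0 < r)%N.
  rewrite /r; case: ifP => om; last by rewrite pmatch_gt0 ?om.
  by rewrite muln_gt0 pmatch_gt0; lia.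
exists r%:R^-1; first by rewrite invr_gt0 ltr0n.
apply/matrixP => i j; rewrite !mxE.
under eq_bigr => k _ do rewrite !mxE.
by rewrite -mulr_suml -natr_sum sum_a_entry -/r divff // pnatr_eq0 -lt0n.
Qed.


(** * The matrix exponential and its nonnegativity *)

Lemma A_mx_exp_solution (R : realType) (m : nat) (s : R) : 0 <= s ->
  exists2 x : 'cV[R]_((m./2).+1), forall i, 0 <= x i 0 &
    A_mx R m *m x = \col_i expR (s * (i * (m - i))%:R).
Proof.
move=> s0; set A := A_mx R m; set T := switch_mx R m.
set h : 'cV[R]__ := \col__ _.
have [c c0 Ac] := A_mx_const R m.
pose y k : 'cV[R]_((m./2).+1) := iter k (mulmx T) (const_mx c).
have y0 k i : 0 <= y k i 0.
  elim: k i => [|k IH] i; first by rewrite /y /= mxE ltW.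
  by rewrite /y /= mxE sumr_ge0 // => j _; rewrite mulr_ge0 // mxE ler0n.
(* Moving [A] past each [T] turns it into D, so A T^k x = D^k A x = D^k 1. *)
have Ay k i : (A *m y k) i 0 = (i * (m - i))%:R ^+ k.
  elim: k i => [|k IH] i; first by rewrite /y /= Ac mxE expr0.
  by rewrite /y /= mulmxA A_mx_switch -mulmxA mul_diag_mx mxE IH mxE exprS.
(* Partial sums of exp (s T) applied to [const_mx c]; [A] maps them to partial sums of the scalar
   exponential series. *)
pose z N := \sum_(k < N) (s ^+ k / k`!%:R) *: y k.
have z0 N i : 0 <= z N i 0.
  rewrite summxE sumr_ge0 // => k _.
  by rewrite mxE mulr_ge0 // divr_ge0 ?exprn_ge0.
have Az N i : (A *m z N) i 0 = series (exp_coeff (s * (i * (m - i))%:R)) N.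
  rewrite /series /= big_mkord mulmx_sumr summxE; apply: eq_bigr => k _.
  by rewrite -scalemxAr mxE Ay /exp_coeff /= exprMn mulrAC.
(* With this witness only scalar series have to converge: applying [invmx A] to their limits shows
   that it is the entrywise limit of the nonnegative [z N]. *)
exists (invmx A *m h); last by rewrite mulKVmx // A_mx_unit.
move=> i; rewrite mxE.
have zE N : z N i 0 =
    \sum_j invmx A i j * series (exp_coeff (s * (j * (m - j))%:R)) N.
  rewrite -[z N](mulKmx (A_mx_unit R m)) mxE.
  by apply: eq_bigr => j _; rewrite Az.
have zcvg : (z N i 0 @[N --> \oo] --> \sum_j invmx A i j * h j 0)%classic.
  under eq_cvg do rewrite zE.
  apply: cvg_big => [|j _]; first exact: add_continuous.
  apply: cvgMl_tmp; rewrite mxE; exact: is_cvg_series_exp_coeff.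
by apply: (cvgr_to_ge zcvg); apply: nearW => N; exact: z0.
Qed.

(** * Hamming weights and the reduction of the theorem *)

Lemma hamming_pin_input (d m a b : nat) (x : m.-tuple bool) :
  (a <= b <= d)%N -> m = (b - a)%N ->
  hamming (pin_input d a b x) = (hamming x + a)%N.
Proof.
move=> /andP[ab bd] mE; rewrite /hamming /pin_input /=.
set s := x ++ _.
have -> : [seq nth false s (val i) | i <- enum 'I_d] = s.
  have ss : size s = d.
    by rewrite /s !size_cat !size_nseq size_tuple mE; lia.
  by rewrite (map_comp (nth false s) val) val_enum_ord -ss; exact: mkseq_nth.
by rewrite /s !count_cat !count_nseq mul0n mul1n add0n.
Qed.

Lemma hamming_compl (m : nat) (x : m.-tuple bool) :
  hamming (compl x) = (m - hamming x)%N.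
Proof.
rewrite /hamming /compl /= count_map.
have := count_predC id x; rewrite size_tuple => xm.
by have /(f_equal (subn^~ (count id x))) := xm; rewrite addKn.
Qed.

Lemma hamming_prefix (m i : nat) : (i <= m)%N ->
  hamming [tuple (j < i)%N | j < m] = i.
Proof.
move=> im; rewrite /hamming /= count_map /=.
rewrite -(count_map val (fun j => (j < i)%N)) val_enum_ord.
rewrite -(subnKC im) iotaD count_cat add0n.
have /eqP -> : count (fun j => (j < i)%N) (iota 0 i) == i.
  rewrite -[X in _ == X](size_iota 0) -all_count.
  by apply/allP => j; rewrite mem_iota.
rewrite (_ : count _ (iota i _) = 0%N) ?addn0 //; apply/eqP.
rewrite -leqn0 leqNgt -has_count -all_predC.
by apply/allP => j; rewrite mem_iota /= -leqNgt => /andP[].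
Qed.

Theorem theorem4 (R : realType) (beta mu : R) (d : nat) (beta_ge0 : 0 <= beta) :
  windable (@Fbmd R beta mu d).
Proof.
move=> m G _ [a [b [abd mE GE]]].
(* [K] is h_0: the exponents at weights [a + i] and [a + m - i] add up to that of [K] plus 2 beta i
   (m - i). *)
pose K : R := expR (beta * (2 * a%:R * (d%:R - a%:R) + m%:R * (d%:R - 2 * a%:R)
  - m%:R ^+ 2) + mu * (2 * a%:R + m%:R)).
have [x x0 Ax] := A_mx_exp_solution R m (2 * beta) (mulr_ge0 (ler0n _ 2) beta_ge0).
exists (K *: x); split=> [i|]; first by rewrite mxE mulr_ge0 // expR_ge0.
rewrite -scalemxAr Ax; apply/matrixP => i j; rewrite !mxE /self_compl !GE.
have im : (i <= m)%N by have := ltn_ord i; lia.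
rewrite /Fbmd !hamming_pin_input // hamming_compl hamming_prefix //.
rewrite /K -!expRD; congr expR.
rewrite !natrD natrM natrB //; ring.
Qed.
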